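(* Let $\{A_n\}_{n\ge1}$ be a sequence of matrices with $A_n\in\mathbf{M}_n(\mathbb{C})$, $\mathrm{Tr}(A_n)=0$ for all $n\ge1$, and $$\sup_{n\ge1}\frac{(\log n)\,\|A_n\|}{n^{1/2}}<\infty .$$ If, for each $n\ge1$, the random variable $X_n$ is uniformly distributed on the unit sphere $\partial\mathbb{B}^n=\{x\in\mathbb{C}^n:\|x\|=1\}$, then $\langle A_nX_n,X_n\rangle$ converges almost surely to zero as $n\to\infty$.
   Context: $\langle x,y\rangle=y^*x$ is the usual scalar product on $\mathbb{C}^n$, $\|x\|=\langle x,x\rangle^{1/2}$, and $\|A\|=\sup\{\|Ax\|:\|x\|=1\}$ is the operator norm. The random variables $X_n$, $n\ge1$, are defined on a common probability space; ''uniformly distributed'' means with law the normalized Euclidean surface measure on $\partial\mathbb{B}^n$. *)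

(* Defs.v *)
From HB Require Import structures.
From mathcomp Require Import all_boot all_order all_algebra.
From mathcomp Require Import complex.
From mathcomp Require Import all_classical all_reals all_analysis.

Set Implicit Arguments.
Unset Strict Implicit.
Unset Printing Implicit Defensive.

Import Order.TTheory GRing.Theory Num.Theory.
Import numFieldNormedType.Exports.

Local Open Scope classical_set_scope.
Local Open Scope ring_scope.

Definition inner (R : realType) (n : nat) (x y : 'cV[R[i]]_n) : R[i] :=
  (map_mx Num.conj y^T *m x) 0 0.

Definition vnorm (R : realType) (n : nat) (x : 'cV[R[i]]_n) : R :=
  Num.sqrt (complex.Re (inner x x)).

Definition sphere (R : realType) (n : nat) : set 'cV[R[i]]_n :=
  [set x | vnorm x = 1].

Definition opnorm (R : realType) (n : nat) (A : 'M[R[i]]_n) : R :=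
  sup [set vnorm (A *m x) | x in @sphere R n].

(* Lebesgue measure on R^m, as the m-fold product of the one-dimensional one
   (R^m carries the library's product sigma-algebra on tuples, i.e. the Borel
   sets). *)
Fixpoint volume (R : realType) (m : nat) : set (m.-tuple R) -> \bar R :=
  match m return set (m.-tuple R) -> \bar R with
  | 0 => \d_[tuple]
  | k.+1 => pushforward (@lebesgue_measure R \x @volume R k)%E
              (fun p : R * k.-tuple R => [tuple of p.1 :: p.2])
  end.

(* The identification C^n = R^(2n): real parts first, then imaginary parts. *)
Definition realify (R : realType) (n : nat) (x : 'cV[R[i]]_n) :
    (n + n).-tuple R :=
  [tuple match fintype.split i with
         | inl j => complex.Re (x j 0)
         | inr j => complex.Im (x j 0)
         end | i < n + n].

Definition cvolume (R : realType) (n : nat) (E : set 'cV[R[i]]_n) : \bar R :=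
  @volume R (n + n) (@realify R n @` E).

(* The part of the unit ball lying over E, with the origin removed. *)
Definition cone (R : realType) (n : nat) (E : set 'cV[R[i]]_n) :
    set 'cV[R[i]]_n :=
  [set z | exists t : R, exists x : 'cV[R[i]]_n,
    [/\ 0 < t, t <= 1, (E `&` @sphere R n) x & z = t%:C%C *: x]].

(* Euclidean surface measure on the unit sphere of C^n = R^(2n), defined through
   polar coordinates: sigma is the measure for which Lebesgue measure is
   r^(2n-1) dr d(sigma), so that sigma(E) = 2n * volume (cone over E). *)
Definition surface_measure (R : realType) (n : nat) (E : set 'cV[R[i]]_n) :
    \bar R :=
  ((n + n)%:R%:E * cvolume (cone E))%E.

(* X is a C^n-valued random variable (Borel measurable) whose law is the
   normalized surface measure.  Borel subsets of C^n are the preimages by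
   realify of the measurable subsets of R^(2n). *)
Definition uniform_on_sphere (R : realType) (d : measure_display)
    (T : measurableType d) (P : probability T R) (n : nat)
    (X : T -> 'cV[R[i]]_n) : Prop :=
  measurable_fun [set: T] (@realify R n \o X) /\
  forall B : set ((n + n).-tuple R), measurable B ->
    P (X @^-1` (@realify R n @^-1` B)) =
    (surface_measure (@realify R n @^-1` B) / surface_measure (@sphere R n))%E.

(* Main.v *)
(* Since [cone] turns surface measure into volume, P(Re <B X, X> > e) is the
   ratio vol(K n ball) / vol(ball), where K is the conic set q(z) > e |z|^2 and
   q the real quadratic form Re <B z, z> on R^(2n).  For a conic set K, scaling
   of Lebesgue measure and Tonelli applied to
     exp(-|z|^2) = \int_(s >= |z|^2) exp(-s) ds
   show that the integral of exp(-|z|^2) over K is vol(K n ball) times a constant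
   depending only on the dimension.  So the ratio of volumes is a ratio of
   Gaussian integrals, and on K one has
     exp(-|z|^2) <= exp(-(|z|^2 + t (e |z|^2 - q(z)))),
   whose integral over the whole space is sqrt(pi^(2n) / det M) with
   M = (1 + t e) 1 - t q.  As q has trace 0 and spectrum in [-L, L], where
   L bounds the operator norm, a suitable t gives the tail bound
   exp(- n e^2 / (8 (L + e)^2)).  With L = O(sqrt n / log n) this is
   exp(- k (log n)^2) = O(n^-2) for some k > 0, and Borel-Cantelli applies to
   c A_n for each c in {1, -1, i, -i}. *)

Require Import Defs.
From HB Require Import structures.
From mathcomp Require Import all_boot all_order all_algebra.
From mathcomp Require Import complex.
From mathcomp Require Import all_classical all_reals all_analysis.
From mathcomp Require Import measurable_realfun ring lra.
Import Order.TTheory GRing.Theory Num.Theory.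
Import numFieldNormedType.Exports.
Local Open Scope classical_set_scope.
Local Open Scope ring_scope.

(** * Lebesgue measure on tuples *)

Section integral_affine.
Context {R : realType}.
Notation mu := (@lebesgue_measure R).

Lemma measurable_affine (a b : R) :
  measurable_fun setT (fun x : measurableTypeR R => a * x + b : measurableTypeR R).
Proof. by apply: measurable_funD => //; exact: measurable_funM. Qed.

(** The image of Lebesgue measure under [x |-> a * x + b], multiplied by [a], gives every half-open
    interval its length, so it is Lebesgue measure again. *)
Lemma integral_affine (a b : R) (f : R -> \bar R) : 0 < a ->
  measurable_fun [set: measurableTypeR R] f -> (forall x, 0 <= f x)%E ->
  (\int[mu]_x f (a * x + b)%R = a^-1%:E * \int[mu]_x f x)%E.
Proof.
move=> a0 mf f0.
pose phi := (fun x : measurableTypeR R => a * x + b : measurableTypeR R).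
have mphi : measurable_fun setT phi := measurable_affine a b.
have [nu nuE] : exists nu : {measure set (measurableTypeR R) -> \bar R},
    pushforward mu phi = nu.
  by unshelve eexists (pushforward mu phi : {measure set (measurableTypeR R) -> \bar R}).
have -> : (\int[mu]_x f (a * x + b)%R = \int[nu]_x f x)%E.
  transitivity (\int[pushforward mu phi]_x f x)%E; last by rewrite nuE.
  by rewrite ge0_integral_pushforward.
have a0' : 0 <= a by exact: ltW.
have -> : (\int[mu]_x f x = \int[mscale (NngNum a0') nu]_x f x)%E.
  apply: eq_measure_integral => A mA _.
  apply: lebesgue_measure_unique => //.
  move=> _ [[c d]] _ <-.
  transitivity (a%:E * pushforward mu phi `]c, d]%classic)%E; last by rewrite nuE.
  rewrite /pushforward.
  have -> : phi @^-1` `]c, d]%classic = `](c - b) / a, (d - b) / a]%classic.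
    apply/seteqP; split => x /=; rewrite !in_itv/= /phi.
      by move=> /andP[h1 h2]; rewrite ltr_pdivrMr// ler_pdivlMr// mulrC ltrBlDr lerBrDr h1.
    by rewrite ltr_pdivrMr// ler_pdivlMr// ltrBlDr lerBrDr mulrC.
  rewrite !lebesgue_measure_itv/= !lte_fin ltr_pM2r ?invr_gt0// ltrD2r.
  case: ifPn => _; last by rewrite mule0.
  rewrite -!EFinB -EFinM; congr (_%:E).
  by rewrite -mulrBl mulrCA divff ?gt_eqF// mulr1 opprB addrA subrK.
rewrite ge0_integral_mscale//= muleA -EFinM mulVf ?gt_eqF//.
by rewrite mul1e.
Qed.

End integral_affine.

Definition consp {R : realType} {m} (p : R * m.-tuple R) : m.+1.-tuple R :=
  [tuple of p.1 :: p.2].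

Lemma measurable_consp {R : realType} m : measurable_fun setT (@consp R m).
Proof. exact: measurable_cons. Qed.

Section cons_measure.
Context {R : realType} (m : nat).
Context (mu : {sigma_finite_measure set (m.-tuple R) -> \bar R}).

(** One recursion step of [volume], over an arbitrary sigma-finite [mu]: the measure structure can
    then climb the dimension by induction. *)
Definition cons_measure : set (m.+1.-tuple R) -> \bar R :=
  pushforward (@lebesgue_measure R \x mu)%E (@consp R m).

Let cons_measure0 : cons_measure set0 = 0%E.
Proof. by rewrite /cons_measure /pushforward preimage_set0 measure0. Qed.

Let cons_measure_ge0 A : (0 <= cons_measure A)%E.
Proof. by rewrite /cons_measure /pushforward; exact: measure_ge0. Qed.

Let cons_measure_sigma_additive : semi_sigma_additive cons_measure.
Proof.
have [nu ->] : exists nu : {measure set (m.+1.-tuple R) -> \bar R},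
    cons_measure = nu.
  unshelve eexists (pushforward (lebesgue_measure \x mu)%E (@consp R m) :
    {measure set _ -> \bar R}) => //.
  exact: (@measurable_consp R).
exact: measure_semi_sigma_additive.
Qed.

HB.instance Definition _ := isMeasure.Build _ _ _ cons_measure
  cons_measure0 cons_measure_ge0 cons_measure_sigma_additive.

Let cons_measure_sigma_finite : sigma_finite setT cons_measure.
Proof.
have /sigma_finiteP[F [FT ndF Foo]] := sigma_finiteT (@lebesgue_measure R).
have /sigma_finiteP[G [GT ndG Goo]] := sigma_finiteT mu.
pose uncons (z : m.+1.-tuple R) : R * m.-tuple R :=
  (thead z, [tuple of behead z]).
have unconsK : cancel (@consp R m) uncons.
  by move=> [x y]; rewrite /uncons /consp theadE; congr pair; apply: val_inj.
have muncons : measurable_fun setT uncons.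
  apply: measurable_fun_pair; first exact: measurable_tnth.
  exact: measurable_behead.
(* Both exhausting sequences are nondecreasing, so the diagonal products already cover
   everything. *)
exists (fun n => uncons @^-1` (F n `*` G n)).
  rewrite -preimage_bigcup (_ : \bigcup_n _ = setT) ?preimage_setT//.
  apply/seteqP; split => // -[x y] _.
  have [k _ Fkx] : (\bigcup_n F n) x by rewrite -FT.
  have [l _ Gly] : (\bigcup_n G n) y by rewrite -GT.
  exists (maxn k l) => //; split.
    by apply: (subsetPset _ _ (ndF _ _ _) _ Fkx); exact: leq_maxl.
  by apply: (subsetPset _ _ (ndG _ _ _) _ Gly); exact: leq_maxr.
move=> n; have [mF Fn] := Foo n; have [mG Gn] := Goo n; split.
  by rewrite -[X in measurable X]setTI; apply: muncons => //; exact: measurableX.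
rewrite /cons_measure /pushforward -comp_preimage.
rewrite (_ : uncons \o _ = id); last by apply/funext => x /=; rewrite unconsK.
by rewrite preimage_id product_measure1E// lte_mul_pinfty// ge0_fin_numE.
Qed.

HB.instance Definition _ := Measure_isSigmaFinite.Build _ _ _ cons_measure
  cons_measure_sigma_finite.

End cons_measure.

Section volume_measure.
Context {R : realType} (m : nat).

(** The existential lets the induction carry the whole structure; the canonical instances on
    [volume] are then read off from this equality. *)
Lemma volume_sigma_finite_measure :
  exists mu : {sigma_finite_measure set (m.-tuple R) -> \bar R},
    @volume R m = mu.
Proof.
elim: m => [|k [mu IH]]; first by exists (\d_[tuple])%E.
by exists (cons_measure k mu); rewrite /= IH.
Qed.

Let volume0 : @volume R m set0 = 0%E.
Proof. by have [mu ->] := volume_sigma_finite_measure; rewrite measure0. Qed.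

Let volume_ge0 A : (0 <= @volume R m A)%E.
Proof. by have [mu ->] := volume_sigma_finite_measure. Qed.

Let volume_sigma_additive : semi_sigma_additive (@volume R m).
Proof.
have [mu ->] := volume_sigma_finite_measure.
exact: measure_semi_sigma_additive.
Qed.

HB.instance Definition _ := isMeasure.Build _ _ _ (@volume R m)
  volume0 volume_ge0 volume_sigma_additive.

Let volume_sigma_finite : sigma_finite setT (@volume R m).
Proof.
by have [mu ->] := volume_sigma_finite_measure; exact: sigma_finiteT.
Qed.

HB.instance Definition _ := Measure_isSigmaFinite.Build _ _ _ (@volume R m)
  volume_sigma_finite.

End volume_measure.

Section volume_integral.
Context {R : realType}.
Local Open Scope ereal_scope.

Lemma integral_volume0 (f : 0.-tuple R -> \bar R) :
  measurable_fun setT f -> \int[@volume R 0]_x f x = f [tuple].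
Proof. by move=> mf; rewrite integral_dirac// diracT mul1e. Qed.

Lemma integral_volumeS m (f : m.+1.-tuple R -> \bar R) :
  measurable_fun setT f -> (forall x, 0 <= f x) ->
  \int[@volume R m.+1]_z f z =
  \int[@lebesgue_measure R]_x \int[@volume R m]_y f (consp (x, y)).
Proof.
move=> mf f0.
transitivity (\int[pushforward (@lebesgue_measure R \x @volume R m) (@consp R m)]_z f z) => //.
rewrite ge0_integral_pushforward//; last exact: (@measurable_consp R).
rewrite preimage_setT fubini_tonelli1//; last by move=> x; exact: f0.
by apply: measurableT_comp => //; exact: (@measurable_consp R).

Qed.

(** Tonelli in the other order: with the first coordinate innermost, it can be integrated out after
    completing the square. *)
Lemma integral_volumeS_sym m (f : m.+1.-tuple R -> \bar R) :
  measurable_fun setT f -> (forall x, 0 <= f x) ->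
  \int[@volume R m.+1]_z f z =
  \int[@volume R m]_y \int[@lebesgue_measure R]_x f (consp (x, y)).
Proof.
move=> mf f0.
transitivity (\int[pushforward (@lebesgue_measure R \x @volume R m) (@consp R m)]_z f z) => //.
rewrite ge0_integral_pushforward//; last exact: (@measurable_consp R).
rewrite preimage_setT fubini_tonelli2//; last by move=> x; exact: f0.
by apply: measurableT_comp => //; exact: (@measurable_consp R).

Qed.

Definition dilate {m} (c : R) (z : m.-tuple R) : m.-tuple R :=
  [tuple (c * tnth z i)%R | i < m].

Lemma measurable_dilate m c : measurable_fun setT (@dilate m c).
Proof.
apply/measurable_fun_tnthP => i.
rewrite (_ : _ \o _ = (fun z => c * tnth z i)%R); last first.
  by apply/funext => z /=; rewrite tnth_mktuple.
by apply: measurable_funM => //; exact: measurable_tnth.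
Qed.

Lemma dilate_consp m c x (y : m.-tuple R) :
  dilate c (consp (x, y)) = consp ((c * x)%R, dilate c y).
Proof.
apply: eq_from_tnth => i; rewrite tnth_mktuple.
by case: (unliftP ord0 i) => [j|] ->; rewrite ?tnth0// !tnthS tnth_mktuple.
Qed.

(** By induction on the dimension, each coordinate contributing one factor [c^-1] by the affine
    substitution. *)
Lemma integral_dilate m (c : R) (f : m.-tuple R -> \bar R) : (0 < c)%R ->
  measurable_fun setT f -> (forall x, 0 <= f x) ->
  \int[@volume R m]_z f (dilate c z) =
  ((c ^-1) ^+ m)%:E * \int[@volume R m]_z f z.
Proof.
move=> c0; elim: m f => [|m IH] f mf f0.
  rewrite !integral_volume0 ?expr0 ?mul1e//; last first.
    by apply: measurableT_comp => //; exact: measurable_dilate.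
  by congr f; exact: tuple0.
rewrite integral_volumeS//; last first.
  by apply: measurableT_comp => //; exact: measurable_dilate.
have mfc : measurable_fun setT (f \o @consp R m).
  by apply: measurableT_comp => //; exact: (@measurable_consp R).
have mfx x : measurable_fun setT (fun y => f (consp (x, y))).
  exact: (measurableT_comp mfc (pair1_measurable _)).
under eq_integral.
  move=> x _.
  under eq_integral do rewrite dilate_consp.
  rewrite (IH (fun y => f (consp (c * x, y)%R)))//.
  over.
have mF : measurable_fun [set: measurableTypeR R]
    (fun x => \int[@volume R m]_y f (consp (x, y))).
  apply: (@measurable_fun_fubini_tonelli_F _ _ _ _ _ _ (f \o @consp R m)).
    exact: mfc.
  by move=> z; exact: f0.
rewrite ge0_integralZl//=; first last.
- by rewrite lee_fin exprn_ge0// invr_ge0 ltW.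
- by move=> x _; apply: integral_ge0.
- apply: (measurableT_comp mF); have := @measurable_affine R c 0.
  by under [X in measurable_fun _ X -> _]eq_fun do rewrite addr0.
under eq_integral => x _ do rewrite -[(c * x)%R]addr0.
rewrite (@integral_affine _ c 0 (fun x => \int[@volume R m]_y f (consp (x, y))))//.
- by rewrite integral_volumeS// muleA -EFinM exprSr.
- by move=> x; apply: integral_ge0.
Qed.

End volume_integral.

(** * Gaussian integrals *)

Section quadratic_forms.
Context {R : realType}.

Definition rvec {m} (x : m.-tuple R) : 'rV[R]_m := \row_i tnth x i.

Definition qform {m} (S : 'M[R]_m) (v : 'rV[R]_m) : R := (v *m S *m v^T) 0 0.

Lemma qformE m (S : 'M[R]_m) v :
  qform S v = \sum_j (\sum_i v 0 i * S i j) * v 0 j.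
Proof. by rewrite /qform mxE; apply: eq_bigr => j _; rewrite !mxE. Qed.

Lemma measurable_qform m (S : 'M[R]_m) :
  measurable_fun setT (fun x : m.-tuple R => qform S (rvec x)).
Proof.
under eq_fun do rewrite qformE.
apply: measurable_sum => j; apply: measurable_funM.
  apply: measurable_sum => i; apply: measurable_funM => //.
  by under eq_fun do rewrite mxE; exact: measurable_tnth.
by under eq_fun do rewrite mxE; exact: measurable_tnth.
Qed.

Lemma qform_scale m (S : 'M[R]_m) c v : qform S (c *: v) = c ^+ 2 * qform S v.
Proof. by rewrite /qform linearZ/= -scalemxAl -scalemxAr -scalemxAl !mxE mulrA. Qed.

Lemma qformD m (S S' : 'M[R]_m) v : qform (S + S') v = qform S v + qform S' v.
Proof. by rewrite /qform mulmxDr mulmxDl mxE. Qed.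

Lemma qformZ m c (S : 'M[R]_m) v : qform (c *: S) v = c * qform S v.
Proof. by rewrite /qform -scalemxAr -scalemxAl mxE. Qed.

Lemma qform_tr m (S : 'M[R]_m) v : qform S^T v = qform S v.
Proof.
have E : v *m S^T *m v^T = (v *m S *m v^T)^T by rewrite !trmx_mul trmxK mulmxA.
by rewrite /qform E mxE.
Qed.

(** The Schur complement of the corner entry, in the form valid for symmetric [S], where the lower
    left block is the transpose of the upper right one. *)
Definition schur {m} (S : 'M[R]_(1 + m)) : 'M[R]_m :=
  drsubmx S - (S 0 0)^-1 *: ((ursubmx S)^T *m ursubmx S).

Lemma symmx_block m (S : 'M[R]_(1 + m)) : S^T = S ->
  S = block_mx (S 0 0)%:M (ursubmx S) (ursubmx S)^T (drsubmx S).
Proof.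
move=> symS; rewrite -[LHS]submxK; congr block_mx.
  by apply/matrixP => i j; rewrite !ord1 !mxE !lshift0.
by rewrite -[in LHS]symS trmx_ursub.
Qed.

(* Completing the square in the first coordinate. *)
Lemma qform_schur m (S : 'M[R]_(1 + m)) (a : R) (y : 'rV[R]_m) :
  S^T = S -> S 0 0 != 0 ->
  qform S (row_mx a%:M y) =
  S 0 0 * (a + (y *m (ursubmx S)^T) 0 0 / S 0 0) ^+ 2 + qform (schur S) y.
Proof.
move=> symS s0; rewrite [in LHS](symmx_block _ _ symS) /qform /schur.
set s := S 0 0; set b := ursubmx S; set D := drsubmx S.
set c := (y *m b^T) 0 0.
have yb : y *m b^T = c%:M by rewrite [LHS]mx11_scalar.
have bu : b *m y^T = c%:M by rewrite -[LHS]trmxK trmx_mul trmxK yb tr_scalar_mx.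
rewrite mul_row_block tr_row_mx mul_row_col tr_scalar_mx mulmxBr mulmxBl.
rewrite !mulmxDl -!mulmxA bu -scalemxAl -scalemxAr !mulmxA yb.
rewrite -[c%:M *m b *m y^T]mulmxA bu -!scalar_mxM.
rewrite !mxE eqxx !mulr1n.
set q := \sum_j _.
field.
by [].
Qed.

(** Left multiplication by the unipotent matrix [U] clears the lower left block and leaves the Schur
    complement on the diagonal. *)
Lemma det_schur m (S : 'M[R]_(1 + m)) : S^T = S -> S 0 0 != 0 ->
  \det S = S 0 0 * \det (schur S).
Proof.
move=> symS s0; rewrite [in LHS](symmx_block _ _ symS) /schur.
set s := S 0 0; set b := ursubmx S; set D := drsubmx S.
pose U : 'M[R]_(1 + m) := block_mx 1%:M 0 (- s^-1 *: b^T) 1%:M.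
have detU : \det U = 1 by rewrite det_lblock !det1 mulr1.
rewrite -[LHS]mul1r -detU -det_mulmx mulmx_block.
rewrite !mul1mx !mul0mx !addr0 mul_mx_scalar scalerA mulrN divff// scaleN1r.
rewrite addNr det_ublock det_scalar1.
by rewrite scaleNr mulNmx -scalemxAl addrC.
Qed.

Definition posdef {m} (S : 'M[R]_m) : Prop :=
  S^T = S /\ forall v : 'rV[R]_m, v != 0 -> 0 < qform S v.

Lemma posdef_corner_gt0 m (S : 'M[R]_(1 + m)) : posdef S -> 0 < S 0 0.
Proof.
move=> [_ pS]; have := pS (delta_mx 0 0).
rewrite /qform -rowE mxE (bigD1 0)//= big1 => [|i i0].
  rewrite !mxE eqxx mulr1 addr0; apply.
  by apply/eqP => /matrixP/(_ 0 0)/eqP; rewrite !mxE eqxx oner_eq0.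
by rewrite !mxE (negbTE i0) mulr0.
Qed.

(** The value of the Schur form at [y] is a value of [S]: the first coordinate is chosen to make the
    completed square vanish. *)
Lemma posdef_schur m (S : 'M[R]_(1 + m)) : posdef S -> posdef (schur S).
Proof.
move=> pdS; have s0 := posdef_corner_gt0 _ _ pdS; case: pdS => symS pS; split.
  rewrite /schur linearB linearZ/= trmx_mul trmxK; congr (_ - _).
  by rewrite trmx_drsub symS.
move=> y y0; pose c := (y *m (ursubmx S)^T) 0 0.
have := pS (row_mx (- (c / S 0 0))%:M y).
rewrite qform_schur ?gt_eqF// -/c addNr expr0n/= mulr0 add0r; apply.
by apply: contra y0 => /eqP; rewrite -row_mx0 => /eq_row_mx[_ ->].
Qed.

End quadratic_forms.

Section gaussian_integral.
Context {R : realType}.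

Lemma integral_gauss1 (s c : R) : 0 < s ->
  (\int[@lebesgue_measure R]_x (expR (- (s * (x + c) ^+ 2)))%:E
   = (Num.sqrt (pi / s))%:E)%E.
Proof.
move=> s0.
have s0' : 0 < Num.sqrt s by rewrite sqrtr_gt0.
transitivity (\int[@lebesgue_measure R]_x
    ((EFin \o gauss_fun) (Num.sqrt s * x + Num.sqrt s * c)%R))%E.
  apply: eq_integral => x _; congr (expR (- _))%:E.
  by rewrite -mulrDr exprMn sqr_sqrtr// ltW.
rewrite integral_affine//; first last.
- by move=> x; rewrite lee_fin gauss_fun_ge0.
- by apply/measurable_EFinP; exact: measurable_gauss_fun.
by rewrite integralT_gauss -EFinM sqrtrM ?pi_ge0// sqrtrV ?ltW// mulrC.
Qed.

Lemma rvec_consp m (x : R) (y : m.-tuple R) :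
  rvec (consp (x, y)) = row_mx x%:M (rvec y) :> 'rV_(1 + m).
Proof.
apply/rowP => i; rewrite !mxE; case: splitP => j ji.
  have -> : i = ord0 by apply: val_inj => /=; move: ji; rewrite ord1.
  by rewrite ord1 mxE eqxx mulr1n tnth0.
have -> : i = lift ord0 j by apply: val_inj.
by rewrite mxE tnthS.
Qed.

Lemma gaussian_integral m (S : 'M[R]_m) : posdef S -> 0 < \det S /\
  (\int[@volume R m]_x (expR (- qform S (rvec x)))%:E =
   (Num.sqrt (pi ^+ m / \det S))%:E)%E.
Proof.
have mE k (A : 'M[R]_k) :
    measurable_fun setT (fun x : k.-tuple R => (expR (- qform A (rvec x)))%:E).
  apply/measurable_EFinP; apply: measurableT_comp => //.
  by apply: measurable_funN; exact: measurable_qform.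
elim: m S => [|m IH] S pdS.
  rewrite det_mx00; split => //.
  rewrite integral_volume0// /qform [X in X *m _]thinmx0 mul0mx mxE.
  by rewrite oppr0 expR0 expr0 divr1 sqrtr1.
have s0 := posdef_corner_gt0 _ _ pdS.
have [detS' IHS] := IH _ (posdef_schur _ _ pdS).
have symS := pdS.1.
have detSE := det_schur m S symS (lt0r_neq0 s0).
split; first by rewrite detSE mulr_gt0.
rewrite integral_volumeS_sym//.
transitivity (\int[@volume R m]_y
    ((Num.sqrt (pi / S ord0 ord0))%:E * (expR (- qform (schur S) (rvec y)))%:E))%E.
  apply: eq_integral => y _.
  under eq_integral => x _.
    rewrite rvec_consp qform_schur ?gt_eqF// opprD expRD EFinM.
    over.
  rewrite ge0_integralZr//.
  - by rewrite integral_gauss1.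
  - apply/measurable_EFinP; apply: measurableT_comp => //; apply: measurable_funN.
    apply: measurable_funM => //; apply: measurable_funX => //.
    exact: measurable_funD.
rewrite ge0_integralZl//.
rewrite IHS -EFinM -sqrtrM; last by rewrite divr_ge0 ?pi_ge0// ltW.
by rewrite detSE exprS invfM mulrACA.
exact: mE.
Qed.

End gaussian_integral.

(** * Volumes of cones *)

Section cone_volume.
Context {R : realType}.

(** Translation by [u] extracts the factor [expR (- u)] and leaves the exponential density of rate
    1, of total mass 1. *)
Lemma exponential_tail (u : R) :
  (\int[@lebesgue_measure R]_s (\1_`[u, +oo[%classic s * expR (- s))%:E = (expR (- u))%:E)%E.
Proof.
have mf v : measurable_fun [set: measurableTypeR R]
    (fun s => (\1_`[v, +oo[%classic s * expR (- s))%:E).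
  apply/measurable_EFinP; apply: measurable_funM => //.
  by apply: measurableT_comp.
have f0 v (s : R) : (0 <= (\1_`[v, +oo[%classic s * expR (- s))%:E)%E.
  by rewrite lee_fin mulr_ge0// expR_ge0.
have := integral_affine 1 u _ ltr01 (mf u) (f0 u); rewrite invr1 mul1e => <-.
under eq_integral => s _.
  have -> : (\1_`[u, +oo[%classic (1 * s + u) * expR (- (1 * s + u)))%:E
     = ((expR (- u))%:E * (exponential_pdf 1 s)%:E)%E.
    rewrite -EFinM mul1r opprD expRD mulrA mulrC; congr (_ * _)%:E.
    rewrite /exponential_pdf patchE indicE mem_setE in_itv/= lerDr andbT.
    rewrite mem_setE in_itv/= andbT.
    by case: ifPn => _; rewrite ?mul0r// !mul1r mulN1r.
  over.
rewrite ge0_integralZl//=.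
- by rewrite integral_exponential_pdf// mule1.
- by apply/measurable_EFinP; exact: measurable_exponential_pdf.
- by move=> s _; rewrite lee_fin exponential_pdf_ge0.
Qed.

(** Encoded as a quadratic form so that measurability and homogeneity are inherited. *)
Definition sqn {m} (z : m.-tuple R) : R := qform 1%:M (rvec z).

Lemma sqnE m (z : m.-tuple R) : sqn z = \sum_i tnth z i ^+ 2.
Proof.
rewrite /sqn /qform mulmx1 mxE; apply: eq_bigr => i _.
by rewrite !mxE expr2.
Qed.

Lemma measurable_sqn m : measurable_fun setT (@sqn m).
Proof. exact: measurable_qform. Qed.

Lemma sqn_ge0 m (z : m.-tuple R) : 0 <= sqn z.
Proof. by rewrite sqnE sumr_ge0// => i _; rewrite sqr_ge0. Qed.

Lemma rvec_dilate m c (z : m.-tuple R) : rvec (dilate c z) = c *: rvec z.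
Proof. by apply/rowP => i; rewrite !mxE tnth_mktuple. Qed.

Lemma qform_dilate m (S : 'M[R]_m) c z :
  qform S (rvec (dilate c z)) = c ^+ 2 * qform S (rvec z).
Proof. by rewrite rvec_dilate qform_scale. Qed.

Lemma sqn_dilate m c (z : m.-tuple R) : sqn (dilate c z) = c ^+ 2 * sqn z.
Proof. exact: qform_dilate. Qed.

Lemma qform_eq0 m (S : 'M[R]_m) z : sqn z = 0 -> qform S (rvec z) = 0.
Proof.
rewrite sqnE => /eqP; rewrite psumr_eq0 => [|i _]; last exact: sqr_ge0.
move=> /allP z0; rewrite qformE big1// => j _; rewrite !mxE.
have /= := z0 j (mem_index_enum _); rewrite sqrf_eq0 => /eqP ->.
by rewrite mulr0.
Qed.

Definition conic {m} (E : set (m.-tuple R)) :=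
  forall c z, 0 < c -> E z -> E (dilate c z).

Lemma dilateK m (c : R) : c != 0 -> cancel (@dilate R m c) (dilate c^-1).
Proof.
by move=> c0 z; apply: eq_from_tnth => i; rewrite !tnth_mktuple mulKf.
Qed.

Lemma conicP m (E : set (m.-tuple R)) c z : conic E -> 0 < c ->
  E (dilate c z) <-> E z.
Proof.
move=> cE c0; split=> [/(cE c^-1)|]; last exact: cE.
by rewrite dilateK ?gt_eqF//; apply; rewrite invr_gt0.
Qed.

Definition unit_part {m} (E : set (m.-tuple R)) := E `&` [set z | sqn z <= 1].

Lemma measurable_sqn_le m (s : R) : measurable [set z : m.-tuple R | sqn z <= s].
Proof.
rewrite (_ : [set _ | _] = @sqn m @^-1` `]-oo, s]%classic).
  by rewrite -[X in measurable X]setTI; apply: measurable_sqn.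
by apply/seteqP; split => z /=; rewrite in_itv.
Qed.

(** Dilation by [(sqrt s)^-1] preserves [E] and carries the ball of squared radius [s] onto the unit
    ball. *)
Lemma volume_conic m (E : set (m.-tuple R)) (s : R) : measurable E ->
  conic E -> 0 < s ->
  volume (E `&` [set z | sqn z <= s]) =
  ((Num.sqrt s ^+ m)%:E * volume (unit_part E))%E.
Proof.
move=> mE cE s0.
have c0 : 0 < Num.sqrt s by rewrite sqrtr_gt0.
have mU : measurable (unit_part E).
  by apply: measurableI => //; exact: measurable_sqn_le.
have := @integral_dilate R m (Num.sqrt s)^-1 (fun z => (\1_(unit_part E) z)%:E).
rewrite invr_gt0 invrK => /(_ c0) H.
have mI : measurable (E `&` [set z | sqn z <= s]).
  by apply: measurableI => //; exact: measurable_sqn_le.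
transitivity (\int[@volume R m]_z
    (\1_(unit_part E) (dilate (Num.sqrt s)^-1 z))%:E)%E.
  rewrite -[E `&` _]setIT -integral_indic//.
  apply: eq_integral => z _; rewrite !indicE; congr (_%:R%:E); congr (nat_of_bool _).
  have cz : E (dilate (Num.sqrt s)^-1 z) <-> E z by apply: conicP; rewrite ?invr_gt0.
  have sz : (sqn (dilate (Num.sqrt s)^-1 z) <= 1) = (sqn z <= s).
    by rewrite sqn_dilate exprVn (sqr_sqrtr (ltW s0)) mulrC ler_pdivrMr// mul1r.
  by apply/idP/idP => /set_mem[/= Ez zs]; apply/mem_set; split => /=;
    rewrite ?sz// -?sz//; apply/cz.
rewrite H; last by move=> z; rewrite lee_fin.
  by rewrite integral_indic// setIT.
by apply/measurable_EFinP; exact: measurable_indic.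
Qed.

(** This is [Gamma (m / 2 + 1)]; being common to all cones of dimension [m], it cancels in ratios of
    volumes. *)
Definition radial_mass m : \bar R :=
  (\int[@lebesgue_measure R]_s
    (\1_`]0%R, +oo[%classic s * (expR (- s) * Num.sqrt s ^+ m))%:E)%E.

(** Write [expR (- sqn z)] as the integral of [expR (- s)] over [s >= sqn z] and exchange the
    integrals: the slice at height [s] is [E] cut by a ball, whose volume scales as
    [sqrt s ^+ m]. *)
Lemma gauss_conic m (E : set (m.-tuple R)) : measurable E -> conic E ->
  (forall z, E z -> 0 < sqn z) ->
  (\int[@volume R m]_z (\1_E z * expR (- sqn z))%:E =
   volume (unit_part E) * radial_mass m)%E.
Proof.
move=> mE cE E0.
pose f (p : m.-tuple R * measurableTypeR R) : \bar R :=
  (\1_E p.1 * (\1_[set p | sqn p.1 <= p.2] p * expR (- p.2)))%:E.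
have f0 p : (0 <= f p)%E by rewrite lee_fin !mulr_ge0// expR_ge0.
have mf : measurable_fun setT f.
  apply/measurable_EFinP; apply: measurable_funM.
    have mE1 : measurable_fun setT (\1_E : m.-tuple R -> R) by exact: measurable_indic.
    exact: (measurableT_comp mE1 measurable_fst).
  apply: measurable_funM; last by apply: measurableT_comp => //; exact: measurable_funN.
  apply: measurable_indic.
  rewrite (_ : [set _ | _] = (fun p => p.2 - sqn p.1) @^-1` `[0, +oo[%classic).
    rewrite -[X in measurable X]setTI; apply: measurable_funB => //.
    by apply: measurableT_comp => //; exact: measurable_sqn.
  by apply/seteqP; split => p /=; rewrite in_itv/= andbT subr_ge0.
transitivity (\int[@volume R m]_z \int[@lebesgue_measure R]_s f (z, s))%E.
  apply: eq_integral => z _.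
  have fE s : f (z, s) =
      ((\1_E z)%:E * (\1_`[sqn z, +oo[%classic s * expR (- s))%:E)%E.
    rewrite -EFinM; congr (_ * (_ * _))%:E; rewrite !indicE.
    congr (_%:R); congr (nat_of_bool _).
    by apply/idP/idP; rewrite !inE/= in_itv/= andbT.
  under eq_integral do rewrite fE.
  rewrite ge0_integralZl//.
  - by rewrite EFinM -exponential_tail.
  - apply/measurable_EFinP; apply: measurable_funM; last exact: measurableT_comp.
    by apply: measurable_indic.
rewrite (@fubini_tonelli _ _ _ _ _ (@volume R m) (@lebesgue_measure R) f mf f0).
under eq_integral => s _.
  have -> : (\int[@volume R m]_z f (z, s) =
      (\1_`]0%R, +oo[%classic s * (expR (- s) * Num.sqrt s ^+ m))%:E * volume (unit_part E))%E.
    have mI : measurable (E `&` [set z | sqn z <= s]).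
      by apply: measurableI => //; exact: measurable_sqn_le.
    have fE z : f (z, s) =
        ((expR (- s))%:E * (\1_(E `&` [set z | sqn z <= s]) z)%:E)%E.
      rewrite -EFinM /f/= mulrA mulrC indicI/=; congr (_ * (_ * _))%:E.
    under eq_integral do rewrite fE.
    have mIE : measurable_fun [set: m.-tuple R]
        (fun z => (\1_(E `&` [set z | sqn z <= s]) z)%:E : \bar R).
      by apply/measurable_EFinP; exact: measurable_indic.
    rewrite (ge0_integralZl _ measurableT mIE)//.
    rewrite integral_indic// setIT.
    transitivity ((expR (- s))%:E * volume (E `&` [set z | (sqn z <= s)%R]))%E => //.
    (* For [s <= 0] the slice is empty, because [sqn] is positive on [E]. *)
    have [s0|s0] := ltP 0 s.
      have -> : \1_`]0%R, +oo[%classic s = 1 :> R.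
        by rewrite indicE mem_set//= in_itv/= s0.
      by rewrite volume_conic// muleA -EFinM mul1r.
    have -> : \1_`]0%R, +oo[%classic s = 0 :> R.
      by rewrite indicE memNset//= in_itv/= andbT; apply/negP; rewrite -leNgt.
    rewrite mul0r mul0e.
    rewrite (_ : _ `&` _ = set0) ?measure0 ?mule0//.
    apply/seteqP; split => z //= -[/E0 z0 zs].
    by have := lt_le_trans z0 (le_trans zs s0); rewrite ltxx.
  over.
pose g (s : measurableTypeR R) : R :=
  \1_`]0%R, +oo[%classic s * (expR (- s) * Num.sqrt s ^+ m).
have mg : measurable_fun setT (EFin \o g).
  apply/measurable_EFinP; apply: measurable_funM => //.
  apply: measurable_funM; first exact: measurableT_comp.
  by apply: measurable_funX; apply: continuous_measurable_fun; exact: sqrt_continuous.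
have g0 s : setT s -> (0 <= (EFin \o g) s)%E.
  by move=> _; rewrite lee_fin !mulr_ge0// ?expR_ge0// exprn_ge0// sqrtr_ge0.
rewrite [RHS]muleC.
exact: (ge0_integralZr _ measurableT mg g0 (measure_ge0 _ _)).
Qed.
End cone_volume.

(** * Ratios of cone volumes bounded by Gaussian determinants *)

Section cone_bound.
Context {R : realType}.

Lemma posdef1 m : posdef (1%:M : 'M[R]_m).
Proof.
split=> [|v v0]; first exact: trmx1.
rewrite qformE lt_neqAle; apply/andP; split; last first.
  apply: sumr_ge0 => j _; rewrite (bigD1 j)//= big1 ?addr0 => [|i ij].
    by rewrite mxE eqxx mulr1 -expr2 sqr_ge0.
  by rewrite mxE (negbTE ij) mulr0.
rewrite eq_sym; apply: contra v0 => /eqP H; apply/eqP/rowP => j.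
have E k : (\sum_i v 0 i * (1%:M : 'M[R]_m) i k) * v 0 k = v 0 k ^+ 2.
  rewrite (bigD1 k)//= big1 ?addr0 => [|i ik]; rewrite mxE ?eqxx ?mulr1//.
  by rewrite (negbTE ik) mulr0.
move: H; under eq_bigr do rewrite E.
move/eqP; rewrite psumr_eq0 => [/allP/(_ j (mem_index_enum _))/=|i _].
  by rewrite sqrf_eq0 mxE => /eqP.
exact: sqr_ge0.
Qed.

Lemma gauss_total m :
  (\int[@volume R m]_z (expR (- sqn z))%:E = (Num.sqrt (pi ^+ m))%:E)%E.
Proof.
by have [_] := gaussian_integral m _ (posdef1 m); rewrite det1 divr1.
Qed.

Lemma measurable_expN_sqn m :
  measurable_fun setT (fun z : m.-tuple R => (expR (- sqn z))%:E).
Proof.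
apply/measurable_EFinP; apply: measurableT_comp => //.
by apply: measurable_funN; exact: measurable_sqn.
Qed.

(* The origin has finite measure and is invariant under dilation by 2. *)
Lemma volume_origin m : (0 < m)%N -> @volume R m [set z | sqn z <= 0] = 0%E.
Proof.
move=> m0; set O := [set z | _].
have mO : measurable O by exact: measurable_sqn_le.
have mO1 : measurable_fun [set: m.-tuple R] (fun z => (\1_O z)%:E : \bar R).
  by apply/measurable_EFinP; exact: measurable_indic.
have vE : (\int[@volume R m]_z (\1_O z)%:E = volume O)%E.
  by rewrite integral_indic// setIT.
have vfin : (volume O < +oo)%E.
  rewrite -vE; apply: (@le_lt_trans _ _ (\int[@volume R m]_z (expR (- sqn z))%:E)%E).
    apply: ge0_le_integral => //; first exact: measurable_expN_sqn.
    move=> z _; rewrite lee_fin indicE.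
    have [zO|] := boolP (z \in O); last by rewrite expR_ge0.
    by rewrite -expR0 ler_expR oppr_ge0; move: zO; rewrite inE.
  by rewrite gauss_total ltry.
have H : volume O = ((2^-1 ^+ m)%:E * volume O)%E.
  rewrite -{2}vE -(@integral_dilate R m 2 (fun z => (\1_O z)%:E)) ?ltr0n//.
  rewrite -vE; apply: eq_integral => z _; rewrite !indicE; congr (_%:R%:E).
  congr (nat_of_bool _); apply/idP/idP; rewrite !inE /O/= sqn_dilate;
    by rewrite pmulr_rle0// exprn_gt0.
have [x xE] : exists x, volume O = x%:E.
  by exists (fine (volume O)); rewrite fineK// ge0_fin_numE.
rewrite xE -EFinM in H *; case: H => H; congr EFin; apply/eqP.
have : (1 - 2^-1 ^+ m) * x = 0 by rewrite mulrBl mul1r -H subrr.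
move/eqP; rewrite mulf_eq0 => /orP[|//].
rewrite subr_eq0 eq_sym => /eqP h; have : 2^-1 ^+ m < 1 :> R.
  by rewrite exprn_ilt1 ?invr_ge0// -?lt0n// invf_lt1// ltr1n.
by rewrite h ltxx.
Qed.

(** The total Gaussian mass in a form suited to [gauss_conic], whose cones must avoid the origin. *)
Lemma gauss_punctured m : (0 < m)%N ->
  (\int[@volume R m]_z (\1_[set z | 0%R < sqn z] z * expR (- sqn z))%:E =
   (Num.sqrt (pi ^+ m))%:E)%E.
Proof.
move=> m0; rewrite -gauss_total.
have mO := @measurable_sqn_le R m 0.
have OE : [set z : m.-tuple R | 0 < sqn z] = ~` [set z | sqn z <= 0].
  by apply/seteqP; split => z /=; [rewrite ltNge => /negP|move/negP; rewrite -ltNge].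
have mP : measurable [set z : m.-tuple R | 0 < sqn z].
  by rewrite OE; exact: measurableC.
have mPe : measurable_fun [set: m.-tuple R]
    (fun z => (\1_[set z | 0%R < sqn z] z * expR (- sqn z))%:E : \bar R).
  apply/measurable_EFinP; apply: measurable_funM; first exact: measurable_indic.
  by apply/measurable_EFinP; exact: measurable_expN_sqn.
have mO1 : measurable_fun [set: m.-tuple R]
    (fun z => (\1_[set z | sqn z <= 0] z)%:E : \bar R).
  by apply/measurable_EFinP; exact: measurable_indic.
(* The indicator of the origin has integral zero, and adding it restores the missing value
   [expR 0 = 1]. *)
transitivity (\int[@volume R m]_z
  ((\1_[set z | 0%R < sqn z] z * expR (- sqn z))%:E + (\1_[set z | sqn z <= 0]%R z)%:E))%E.
  rewrite ge0_integralD//.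
    rewrite [X in (_ + X)%E]integral_indic// setIT.
    by rewrite [X in (_ + X)%E](volume_origin m m0) adde0.
apply: eq_integral => z _; rewrite -EFinD; congr EFin; rewrite !indicE.
have [z0|z0] := ltP 0 (sqn z).
  by rewrite mem_set// memNset ?mul1r ?addr0//=; apply/negP; rewrite -ltNge.
rewrite memNset/=; last by apply/negP; rewrite -leNgt.
rewrite mem_set//= mul0r add0r.
have -> : sqn z = 0 by apply/eqP; rewrite eq_le z0 sqn_ge0.
by rewrite oppr0 expR0.
Qed.

(** Both volumes are Gaussian integrals divided by the same radial mass, and on [K] the Gaussian is
    dominated by that of [M], of integral [sqrt (pi ^+ m / \det M)]. *)
Lemma cone_volume_bound m (M : 'M[R]_m) (K : set (m.-tuple R)) :
  (0 < m)%N -> posdef M -> measurable K -> conic K ->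
  (forall z, K z -> 0 < sqn z) ->
  (forall z, K z -> qform M (rvec z) <= sqn z) ->
  exists a b : R, [/\ volume (unit_part K) = a%:E,
    volume (unit_part [set z : m.-tuple R | 0 < sqn z]) = b%:E,
    0 < b & a * Num.sqrt (\det M) <= b].
Proof.
move=> m0 pdM mK cK K0 KM.
set P := [set z : m.-tuple R | 0 < sqn z].
have mP : measurable P.
  rewrite (_ : P = ~` [set z | sqn z <= 0]).
    by apply: measurableC; exact: measurable_sqn_le.
  by apply/seteqP; split => z; rewrite /P/= ltNge => /negP.
have cP : conic P.
  by move=> c z c0; rewrite /P/= sqn_dilate => z0; rewrite mulr_gt0// exprn_gt0.
have EP := gauss_conic m P mP cP (fun z h => h).
have EK := gauss_conic m K mK cK K0.
have [detM EM] := gaussian_integral m M pdM.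
have sP : 0 < Num.sqrt (pi ^+ m) :> R by rewrite sqrtr_gt0 exprn_gt0// pi_gt0.
have sM : 0 < Num.sqrt (\det M) by rewrite sqrtr_gt0.
rewrite gauss_punctured// in EP.
have {EK EM} EK : (volume (unit_part K) * radial_mass m <=
    (Num.sqrt (pi ^+ m) / Num.sqrt (\det M))%:E)%E.
  rewrite -(sqrtrV (ltW detM)) -sqrtrM ?exprn_ge0 ?pi_ge0// -EM -EK.
  apply: ge0_le_integral => //.
  - apply/measurable_EFinP; apply: measurable_funM; first exact: measurable_indic.
    by apply/measurable_EFinP; exact: measurable_expN_sqn.
  - apply/measurable_EFinP; apply: measurableT_comp => //.
    by apply: measurable_funN; exact: measurable_qform.
  - move=> z _; rewrite lee_fin indicE; have [zK|] := boolP (z \in K); last first.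
      by rewrite mul0r expR_ge0.
    by rewrite mul1r ler_expR lerN2 KM//; move: zK; rewrite inE.
have bP : (0 <= volume (unit_part P))%E by exact: measure_ge0.
have bK : (0 <= volume (unit_part K))%E by exact: measure_ge0.
have bG : (0 <= radial_mass m :> \bar R)%E.
  by apply: integral_ge0 => s _; rewrite lee_fin !mulr_ge0// ?expR_ge0// exprn_ge0// sqrtr_ge0.
(* By [EP], the radial mass times the volume of the punctured ball is positive and finite, hence so
   is each factor, and division is legitimate. *)
have [G0|G0] : radial_mass m = 0%E :> \bar R \/ (0 < radial_mass m :> \bar R)%E.
- by move: bG; rewrite le_eqVlt => /predU1P[<-|]; [left|right].
- by move: EP; rewrite G0 mule0 => -[] /eqP; rewrite gt_eqF.
have vP0 : (0 < volume (unit_part P))%E.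
  rewrite lt_neqAle bP andbT; apply/eqP => v0.
  by move: EP; rewrite -v0 mul0e => -[] /eqP; rewrite gt_eqF.
case: (radial_mass m) EP EK bG G0 => [g| |] //; last first.
  by rewrite gt0_muley.
rewrite lte_fin => + + _ g0.
case: (volume (unit_part P)) bP vP0 => [b| |] // _; last by rewrite gt0_mulye ?lte_fin.
rewrite lte_fin -EFinM => b0 [Eb].
case: (volume (unit_part K)) bK => [a| |] // _; last by rewrite gt0_mulye ?lte_fin.
rewrite -EFinM lee_fin => Ea; exists a, b; split => //.
move: Ea; rewrite Eb ler_pdivlMr// -mulrA [g * _]mulrC mulrA.
by rewrite ler_pM2r.
Qed.

End cone_bound.

(** * Determinant bound *)

Section spectral_bound.
Context {R : realType}.

Lemma conjE (z : R[i]) : Num.conj z = conjc z.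
Proof. by []. Qed.

(** As [S] is real, the products of a real part with an imaginary part only enter the imaginary part
    of the form. *)
Lemma Re_conj_form m (S : 'M[R]_m) (w : 'rV[R[i]]_m) :
  complex.Re ((w *m map_mx (real_complex R) S *m map_mx Num.conj w^T) 0 0) =
  qform S (map_mx (@complex.Re R) w) + qform S (map_mx (@complex.Im R) w).
Proof.
rewrite !qformE mxE raddf_sum -big_split/=; apply: eq_bigr => j _.
rewrite !mxE !mulr_suml raddf_sum -big_split/=; apply: eq_bigr => i _.
rewrite !mxE; case: (w 0 i) => a b; case: (w 0 j) => c d /=.
ring.
Qed.

(** Seen over [R[i]], [S] is Hermitian, so it is unitarily diagonalizable with real eigenvalues;
    trace and determinant return to [R] by injectivity of the embedding. *)
Lemma real_symmetric_spectrum m (S : 'M[R]_m) (L : R) : S^T = S ->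
  (forall v, `|qform S v| <= L * qform 1%:M v) ->
  exists l : 'I_m -> R, [/\ \tr S = \sum_i l i,
    forall a b, \det (a%:M + b *: S) = \prod_i (a + b * l i) &
    forall i, `|l i| <= L].
Proof.
move=> symS bS.
pose SC : 'M[R[i]]_m := map_mx (real_complex R) S.
have hS : SC \is hermsymmx.
  apply/is_hermitianmxP; rewrite expr0 scale1r; apply/matrixP => i j.
  by rewrite !mxE conjE conjc_real -[in LHS]symS mxE.
have /orthomx_spectralP := hermitian_normalmx hS.
have /mxOverP dreal := hermitian_spectral_diag_real hS.
have := spectral_unitarymx SC.
set U := spectralmx SC; set d := spectral_diag SC in dreal * => uU SE.
have unU : U \in unitmx by exact: unitarymx_unit.
pose l i := complex.Re (d 0 i).
have dl i : d 0 i = real_complex R (l i) by rewrite /l RRe_real.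
have detE a b : \det (a%:M + b *: S) = \prod_i (a + b * l i).
  apply: (@complexI R); rewrite -det_map_mx map_mxD map_scalar_mx map_mxZ -/SC SE.
  have -> : (real_complex R a)%:M + real_complex R b *: (invmx U *m diag_mx d *m U) =
    invmx U *m (diag_mx (const_mx (real_complex R a) + real_complex R b *: d)) *m U.
    rewrite linearD/= linearZ/= diag_const_mx mulmxDr mulmxDl.
    rewrite [invmx U *m _%:M]scalar_mxC -[_%:M *m _ *m _]mulmxA mulVmx// mulmx1; congr (_ + _).
    by rewrite -scalemxAr -scalemxAl.
  rewrite !det_mulmx det_inv mulrAC mulVr ?mul1r -?unitmxE// det_diag.
  by rewrite rmorph_prod; apply: eq_bigr => i _; rewrite !mxE dl rmorphD rmorphM.
exists l; split => //.
  apply: (@complexI R); rewrite -trace_map_mx -/SC SE mxtrace_mulC mulmxA.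
  rewrite mulmxV// mul1mx mxtrace_diag rmorph_sum.
  by apply: eq_bigr => i _; rewrite dl.
(* The rows of [U] form an orthonormal eigenbasis: [wE] yields [l i] at [S] and 1 at the identity,
   so the bound on real vectors applies to the real and imaginary parts of [w]. *)
move=> i; pose w := row i U.
have USU : U *m SC *m map_mx Num.conj U^T = diag_mx d.
  by rewrite SE !mulmxA mulmxV// mul1mx -mulmxA (unitarymxP uU) mulmx1.
have UU : U *m map_mx (real_complex R) 1%:M *m map_mx Num.conj U^T = 1%:M.
  by rewrite map_mx1 mulmx1 (unitarymxP uU).
have wE (B : 'M[R]_m) :
  qform B (map_mx (@complex.Re R) w) + qform B (map_mx (@complex.Im R) w) =
  complex.Re ((U *m map_mx (real_complex R) B *m map_mx Num.conj U^T) i i).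
  rewrite -Re_conj_form; congr complex.Re.
  by rewrite -row_mul !mxE; apply: eq_bigr => j _; rewrite !mxE.
have lE := wE S; rewrite USU mxE eqxx mulr1n -/(l i) in lE.
have oneE := wE 1%:M; rewrite UU mxE eqxx mulr1n/= in oneE.
rewrite -lE (le_trans (ler_normD _ _))//.
by rewrite -[leRHS]mulr1 -oneE mulrDr lerD.
Qed.

(* From [1 + x <= expR x] at [x = y / (1 - y)]. *)
Lemma ge_expR_1B (y : R) : y <= 2^-1 -> expR (- y - y ^+ 2 *+ 2) <= 1 - y.
Proof.
move=> y2; have y1 : 0 < 1 - y by lra.
rewrite -opprD expRN -[leRHS]invrK lef_pV2 ?posrE ?invr_gt0 ?expR_gt0//.
apply: (@le_trans _ _ (expR (y / (1 - y)))).
  have := expR_ge1Dx (y / (1 - y)).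
  rewrite (_ : 1 + y / (1 - y) = (1 - y)^-1)//.
  by field; apply: lt0r_neq0.
rewrite ler_expR ler_pdivrMr// -subr_ge0.
have -> : (y + y ^+ 2 *+ 2) * (1 - y) - y = y ^+ 2 * (1 - y *+ 2) by ring.
by rewrite mulr_ge0 ?sqr_ge0// mulr2n; lra.
Qed.

(** With [y i = t * (l i - e)], the determinant is the product of the [1 - y i], where
    [|y i| <= t * (L + e) <= 1/4], so [ge_expR_1B] applies to each factor. The given [t] maximizes
    the resulting exponent [t * e - 2 * t ^+ 2 * (L + e) ^+ 2] per eigenvalue. *)
Lemma det_tilt m (S : 'M[R]_m) (L e : R) : S^T = S -> \tr S = 0 -> 0 <= L -> 0 < e ->
  (forall v, `|qform S v| <= L * qform 1%:M v) ->
  let t := e / (4 * (L + e) ^+ 2) in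
  let M := (1 + t * e)%:M + (- t) *: S in
  posdef M /\ expR (m%:R * e ^+ 2 / (8 * (L + e) ^+ 2)) <= \det M.
Proof.
move=> symS trS L0 e0 bS t.
have Le : 0 < L + e by lra.
have t0 : 0 < t by rewrite divr_gt0// mulr_gt0// exprn_gt0.
have tLe : t * (L + e) <= 4^-1.
  have -> : t * (L + e) = e / (4 * (L + e)) by rewrite /t; field; exact: lt0r_neq0.
  by rewrite ler_pdivrMr ?mulr_gt0//; lra.
have te : 0 < t * e by rewrite mulr_gt0.
have tL : t * L <= 4^-1 by apply: le_trans tLe; rewrite ler_pM2l//; lra.
move=> M; split.
  split; first by rewrite /M linearD/= linearZ/= tr_scalar_mx symS.
  move=> v v0; rewrite /M qformD qformZ -scalemx1 qformZ.
  have q1 : 0 < qform 1%:M v by exact: (posdef1 m).2.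
  have := bS v; rewrite ler_norml => /andP[_ h].
  have : t * qform S v <= 4^-1 * qform 1%:M v.
    by rewrite (le_trans (ler_wpM2l (ltW t0) h))// mulrA ler_pM2r.
  have : 0 < t * e * qform 1%:M v by rewrite mulr_gt0.
  by move: q1; lra.
have [l [trl detl lL]] := real_symmetric_spectrum m S L symS bS.
rewrite detl; pose y i := t * (l i - e).
have yle i : `|y i| <= t * (L + e).
  rewrite /y normrM (gtr0_norm t0) ler_pM2l// (le_trans (ler_normB _ _))//.
  by rewrite lerD// gtr0_norm.
apply: (@le_trans _ _ (\prod_i expR (- y i - y i ^+ 2 *+ 2))); last first.
  apply: ler_prod => i _; rewrite expR_ge0/=.
  have -> : 1 + t * e + - t * l i = 1 - y i by rewrite /y; ring.
  by apply: ge_expR_1B; have := yle i; rewrite ler_norml => /andP[_]; lra.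
rewrite -expR_sum ler_expR.
(* The terms [t * l i] sum to [t * \tr S = 0]: the first order contribution of the spectrum
   disappears. *)
have -> : m%:R * e ^+ 2 / (8 * (L + e) ^+ 2) =
   \sum_(i < m) (t * e - (t * (L + e)) ^+ 2 *+ 2 - t * l i).
  rewrite sumrB -mulr_sumr -trl trS mulr0 subr0 sumr_const card_ord.
  rewrite -mulr_natl /t; field; exact: lt0r_neq0.
apply: ler_sum => i _.
have : y i ^+ 2 <= (t * (L + e)) ^+ 2.
  rewrite -[y i ^+ 2]real_normK ?num_real//.
  by rewrite ler_pXn2r ?nnegrE ?yle// mulr_ge0 ?(ltW t0) ?(ltW Le).
by rewrite /y !mulr2n mulrBr; lra.
Qed.

End spectral_bound.

(** * From complex matrices to real quadratic forms *)

Section realification.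
Context {R : realType} {n : nat}.
Implicit Types z : 'cV[R[i]]_n.
Local Notation Re := (@complex.Re R).
Local Notation Im := (@complex.Im R).

Lemma tnth_realify_lshift z j : tnth (realify z) (lshift n j) = Re (z j 0).
Proof. by rewrite tnth_mktuple (unsplitK (inl j)). Qed.

Lemma tnth_realify_rshift z j : tnth (realify z) (rshift n j) = Im (z j 0).
Proof. by rewrite tnth_mktuple (unsplitK (inr j)). Qed.

Lemma rvec_realify z :
  rvec (realify z) = row_mx (map_mx Re z)^T (map_mx Im z)^T.
Proof.
apply/rowP => i; rewrite mxE -(splitK i); case: (fintype.split i) => j /=.
  by rewrite tnth_realify_lshift row_mxEl !mxE.
by rewrite tnth_realify_rshift row_mxEr !mxE.
Qed.

Lemma realify_surj (v : (n + n).-tuple R) : exists z, realify z = v.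
Proof.
exists (\col_j (tnth v (lshift n j) +i* tnth v (rshift n j))%C).
apply: eq_from_tnth => i; rewrite -(splitK i); case: (fintype.split i) => j /=.
  by rewrite tnth_realify_lshift mxE.
by rewrite tnth_realify_rshift mxE.
Qed.

Lemma realify_scale (c : R) z : realify (c%:C%C *: z) = dilate c (realify z).
Proof.
apply: eq_from_tnth => i; rewrite [RHS]tnth_mktuple -(splitK i).
case: (fintype.split i) => j /=.
  by rewrite !tnth_realify_lshift mxE; case: (z j 0) => a b /=; rewrite mul0r subr0.
by rewrite !tnth_realify_rshift mxE; case: (z j 0) => a b /=; rewrite mul0r addr0.
Qed.

Lemma Re_inner x z :
  Re (inner x z) = \sum_i tnth (realify x) i * tnth (realify z) i.
Proof.
rewrite big_split_ord/= /inner mxE raddf_sum -big_split/=; apply: eq_bigr => j _.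
rewrite !tnth_realify_lshift !tnth_realify_rshift !mxE conjE.
case: (x j 0) => a b; case: (z j 0) => c d /=; ring.
Qed.

Lemma vnormE z : vnorm z = Num.sqrt (sqn (realify z)).
Proof.
by rewrite /vnorm Re_inner sqnE; under eq_bigr do rewrite -expr2.
Qed.

Lemma sphereE z : sphere z <-> sqn (realify z) = 1.
Proof.
rewrite /sphere/= vnormE; split => [h|->]; last exact: sqrtr1.
by rewrite -[LHS]sqr_sqrtr ?sqn_ge0// h expr1n.
Qed.

(** [M] is the matrix of [z |-> B *m z] in the coordinates of [realify]; symmetrizing keeps its
    quadratic form and makes the spectral theorem applicable. *)
Definition real_form (B : 'M[R[i]]_n) : 'M[R]_(n + n) :=
  let M := block_mx (map_mx Re B) (- map_mx Im B) (map_mx Im B) (map_mx Re B) in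
  2^-1 *: (M + M^T).

Lemma tr_real_form B : (real_form B)^T = real_form B.
Proof. by rewrite linearZ/= linearD/= trmxK addrC. Qed.

Lemma trace_real_form B : \tr (real_form B) = Re (\tr B) *+ 2.
Proof.
rewrite /real_form mxtraceZ mxtraceD mxtrace_tr mxtrace_block.
have -> : \tr (map_mx Re B) = Re (\tr B).
  by rewrite /mxtrace raddf_sum; apply: eq_bigr => i _; rewrite mxE.
by field.
Qed.

Lemma qform_real_form B z :
  qform (real_form B) (rvec (realify z)) = Re (inner (B *m z) z).
Proof.
rewrite /real_form; set M := block_mx _ _ _ _.
rewrite qformZ qformD qform_tr.
have -> (a : R) : 2^-1 * (a + a) = a by field.
set x := map_mx Re z; set y := map_mx Im z.
set P := map_mx Re B in M *; set Q := map_mx Im B in M *.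
have ReB : map_mx Re (B *m z) = P *m x - Q *m y.
  apply/colP => i; rewrite !mxE raddf_sum -sumrB; apply: eq_bigr => j _.
  by rewrite !mxE; case: (B i j) => a b; case: (z j 0).
have ImB : map_mx Im (B *m z) = Q *m x + P *m y.
  apply/colP => i; rewrite !mxE raddf_sum -big_split; apply: eq_bigr => j _.
  by rewrite !mxE; case: (B i j) => a b; case: (z j 0) => c d /=; rewrite addrC.
have -> : Re (inner (B *m z) z) =
    (x^T *m map_mx Re (B *m z) + y^T *m map_mx Im (B *m z)) 0 0.
  rewrite Re_inner big_split_ord/= !mxE; congr (_ + _); apply: eq_bigr => j _.
    by rewrite !tnth_realify_lshift mulrC !mxE.
  by rewrite !tnth_realify_rshift mulrC !mxE.
rewrite ReB ImB /qform rvec_realify -/x -/y tr_row_mx !trmxK /M.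
rewrite mul_row_block mul_row_col; congr (fun_of_matrix _ 0 0).
rewrite mulmxBr mulmxDr !mulmxDl !mulmxN !mulNmx !mulmxA.
exact: addrACA.
Qed.

(** Homogeneity reduces to a unit vector [x], where the form is the real scalar product of [B *m x]
    and [x]. *)
Lemma real_form_bound B L : 0 < L ->
  (forall x, sphere x -> vnorm (B *m x) <= L) ->
  forall v, `|qform (real_form B) v| <= L * qform 1%:M v.
Proof.
move=> L0 BL v.
have [t <-] : exists t, rvec t = v.
  exists [tuple v 0 i | i < n + n].
  by apply/rowP => i; rewrite mxE tnth_mktuple.
have [z <-] := realify_surj t.
have [z0|z0] := eqVneq (sqn (realify z)) 0.
  by rewrite qform_eq0// normr0 -/(sqn _) z0 mulr0.
have zp : 0 < sqn (realify z) by rewrite lt_neqAle eq_sym z0 sqn_ge0.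
set r := Num.sqrt (sqn (realify z)).
have r0 : 0 < r by rewrite sqrtr_gt0.
have r2 : r ^+ 2 = sqn (realify z) by rewrite sqr_sqrtr// ltW.
pose x := (r^-1)%:C%C *: z.
have zx : realify z = dilate r (realify x).
  rewrite realify_scale -[r in dilate r]invrK dilateK//.
  by rewrite invr_eq0 gt_eqF.
have sx : sqn (realify x) = 1.
  by rewrite realify_scale sqn_dilate -r2 exprVn mulVf// expf_neq0// gt_eqF.
rewrite zx -/(sqn _) qform_dilate sqn_dilate sx mulr1 normrM.
rewrite (ger0_norm (sqr_ge0 _)) mulrC ler_pM2r ?exprn_gt0//.
rewrite qform_real_form Re_inner.
set u := B *m x.
have su : sqn (realify u) <= L ^+ 2.
  have /BL := (sphereE x).2 sx.
  rewrite vnormE -/u => h; rewrite -[leLHS]sqr_sqrtr ?sqn_ge0//.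
  by rewrite ler_pXn2r ?nnegrE ?sqrtr_ge0// ltW.
apply: (le_trans (ler_norm_sum _ _ _)).
(* Weighted form of [2 |a b| <= a^2 / L + L b^2]: as [sqn (realify u) <= L ^+ 2] and [x] is a unit
   vector, each half of the sum contributes at most [L / 2]. *)
apply: (@le_trans _ _ (\sum_i (tnth (realify u) i ^+ 2 / L
    + L * tnth (realify x) i ^+ 2) / 2)).
  apply: ler_sum => i _; rewrite normrM.
  rewrite -(real_normK (num_real (tnth (realify u) i))).
  rewrite -(real_normK (num_real (tnth (realify x) i))).
  set a := `|_|; set b := `|_|.
  rewrite ler_pdivlMr// -subr_ge0.
  have -> : a ^+ 2 / L + L * b ^+ 2 - a * b * 2 = (a - L * b) ^+ 2 / L.
    by field; exact: lt0r_neq0.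
  by rewrite mulr_ge0 ?sqr_ge0// invr_ge0 ltW.
rewrite -mulr_suml big_split/= -mulr_suml -mulr_sumr -!sqnE sx mulr1.
have : sqn (realify u) / L <= L by rewrite ler_pdivrMr// -expr2.
lra.
Qed.

(** [cone] sees only the part of [E] on the sphere, so [E] may be replaced by any conic [K] with the
    same trace there. *)
Lemma realify_cone (E : set 'cV[R[i]]_n) (K : set ((n + n).-tuple R)) :
  conic K -> (forall v, K v -> 0 < sqn v) ->
  (forall x, sphere x -> (E x <-> K (realify x))) ->
  @realify R n @` cone E = unit_part K.
Proof.
move=> cK K0 EK; apply/seteqP; split => [_ [_ [t [x [t0 t1 [Ex sx] ->]]] <-]|v [Kv v1]].
  rewrite realify_scale; split; first by apply: cK => //; exact/EK.
  by rewrite /= sqn_dilate (sphereE _).1// mulr1 exprn_ile1// ltW.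
have [z zv] := realify_surj v; subst v.
set t := Num.sqrt (sqn (realify z)).
have t0 : 0 < t by rewrite sqrtr_gt0 K0.
have t2 : t ^+ 2 = sqn (realify z) by rewrite sqr_sqrtr// sqn_ge0.
pose x := (t^-1)%:C%C *: z.
have sx : sphere x.
  by apply/sphereE; rewrite realify_scale sqn_dilate -t2 exprVn mulVf// expf_neq0// gt_eqF.
exists z => //; exists t, x; split => //.
- by rewrite -sqrtr1 ler_sqrt.
- split=> //; apply/EK => //; rewrite realify_scale; apply: cK => //.
  by rewrite invr_gt0.
- by rewrite scalerA -rmorphM/= mulfV ?gt_eqF// scale1r.
Qed.

End realification.

(** * Tail bound in a fixed dimension *)

Section tail_bound.
Context {R : realType} (n : nat).

(** The probability is a ratio of cone volumes in real dimension [n + n], to which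
    [cone_volume_bound] applies with the tilted matrix of [det_tilt]. *)
Lemma uniform_tail d (T : measurableType d) (P : probability T R)
    (X : T -> 'cV[R[i]]_n) (B : 'M[R[i]]_n) (L e : R) :
  (0 < n)%N -> uniform_on_sphere P X -> 0 < L -> 0 < e ->
  complex.Re (\tr B) = 0 ->
  (forall x, sphere x -> vnorm (B *m x) <= L) ->
  let F := [set w | e < complex.Re (inner (B *m X w) (X w))] in
  measurable F /\
  (P F <= (expR (- (n%:R * e ^+ 2 / (8 * (L + e) ^+ 2))))%:E)%E.
Proof.
move=> n0 [mX uX] L0 e0 trB BL F.
set S := real_form B.
have n2 : (0 < n + n)%N by rewrite addn_gt0 n0.
pose V := [set v : (n + n).-tuple R | e < qform S (rvec v)].
have mV : measurable V.
  rewrite (_ : V = (fun v => qform S (rvec v)) @^-1` `]e, +oo[%classic).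
    by rewrite -[X in measurable X]setTI; exact: measurable_qform.
  by apply/seteqP; split => v /=; rewrite in_itv/= andbT.
have FE : F = X @^-1` (@realify R n @^-1` V).
  by apply/seteqP; split => w; rewrite /F /V/= qform_real_form.
split.
  by rewrite FE -[X in measurable X]setTI; exact: mX.
rewrite FE uX//.
(* The homogenization of [V]: conic, and equal to [V] on the unit sphere. *)
pose K := [set v : (n + n).-tuple R | e * sqn v < qform S (rvec v)].
have mK : measurable K.
  rewrite (_ : K = (fun v => qform S (rvec v) - e * sqn v) @^-1` `]0, +oo[%classic).
    rewrite -[X in measurable X]setTI; apply: measurable_funB => //.
      exact: measurable_qform.
    by apply: measurable_funM => //; exact: measurable_sqn.
  by apply/seteqP; split => v /=; rewrite in_itv/= andbT subr_gt0.
have cK : conic K.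
  move=> c v c0; rewrite /K/= sqn_dilate qform_dilate mulrCA.
  by rewrite ltr_pM2l// exprn_gt0.
have K0 v : K v -> 0 < sqn v.
  rewrite /K/= => h; rewrite lt_neqAle sqn_ge0 andbT; apply/eqP => v0.
  by move: h; rewrite -v0 mulr0 qform_eq0// ltxx.
have trS : \tr S = 0 by rewrite trace_real_form trB mul0rn.
have [pdM detM] := det_tilt _ S L e (tr_real_form B) trS (ltW L0) e0
  (real_form_bound B L L0 BL).
set M := _ + _ in pdM detM.
(* The form of [M] is [sqn v - t * (qform S (rvec v) - e * sqn v)], and the bracket is positive on
   [K]. *)
have KM v : K v -> qform M (rvec v) <= sqn v.
  rewrite /K/= => h; rewrite /M qformD qformZ -scalemx1 qformZ -/(sqn v).
  set t := e / _.
  have t0 : 0 < t by rewrite divr_gt0// mulr_gt0// exprn_gt0// addr_gt0.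
  have : 0 <= t * (qform S (rvec v) - e * sqn v).
    by apply: mulr_ge0; [exact: ltW|rewrite subr_ge0; exact: ltW].
  by rewrite mulrBr mulNr; lra.
have [a [b [aE bE b0 ab]]] := cone_volume_bound _ M K n2 pdM mK cK K0 KM.
rewrite /surface_measure /cvolume (realify_cone _ _ cK K0); last first.
  by move=> x /sphereE sx; rewrite /V/K/= sx mulr1.
rewrite (realify_cone (@sphere R n) [set v | 0 < sqn v]); first last.
- by move=> x sx; rewrite /= (sphereE _).1.
- by [].
- move=> c v c0; rewrite /= sqn_dilate => v0.
  by rewrite mulr_gt0// exprn_gt0.
(* The factor [n + n] of the surface measure cancels, leaving [a / b]. *)
rewrite aE bE -!EFinM inver gt_eqF; last by rewrite mulr_gt0// ltr0n.
rewrite -EFinM lee_fin invfM mulrACA divff ?mul1r; last by rewrite pnatr_eq0 -lt0n.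
rewrite ler_pdivrMr// expRN.
set D := n%:R * _ / _.
(* The square root halves the exponent given by [det_tilt] in dimension [n + n], hence the factor
   [n] in [D]. *)
have sD : expR D <= Num.sqrt (\det M).
  rewrite -[expR D]ger0_norm ?expR_ge0// -sqrtr_sqr ler_wsqrtr// -expRM_natl.
  apply: le_trans detM; rewrite ler_expR /D natrD.
  lra.
rewrite mulrC ler_pdivlMr ?expR_gt0//; apply: le_trans ab.
by rewrite ler_wpM2l// -lee_fin -aE measure_ge0.
Qed.

End tail_bound.

(** * Operator norm *)

Section operator_norm.
Context {R : realType} {n : nat}.
Implicit Types (A B : 'M[R[i]]_n) (x y : 'cV[R[i]]_n).

Lemma inner_adjoint B x :
  inner (B *m x) (B *m x) = inner (map_mx Num.conj B^T *m B *m x) x.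
Proof. by rewrite /inner trmx_mul map_mxM !mulmxA. Qed.

Lemma innerZl (c : R[i]) x y : inner (c *: x) y = c * inner x y.
Proof. by rewrite /inner -scalemxAr mxE. Qed.

Lemma innerZr (c : R[i]) x y : inner x (c *: y) = conjc c * inner x y.
Proof. by rewrite /inner linearZ/= map_mxZ -scalemxAl mxE. Qed.

Lemma vnormZ (c : R[i]) x : conjc c * c = 1 -> vnorm (c *: x) = vnorm x.
Proof. by move=> c1; rewrite /vnorm innerZl innerZr mulrA [c * _]mulrC c1 mul1r. Qed.

(** A crude bound from [|v_i| <= 1], which serves to show that the supremum in [opnorm] is
    finite. *)
Lemma qform_le_sum m (S : 'M[R]_m) (v : m.-tuple R) : sqn v = 1 ->
  `|qform S (rvec v)| <= \sum_j \sum_i `|S i j|.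
Proof.
move=> v1.
have vle i : `|tnth v i| <= 1.
  rewrite -(@expr_le1 _ 2)// real_normK ?num_real// -v1 sqnE (bigD1 i)//= lerDl.
  by apply: sumr_ge0 => j _; exact: sqr_ge0.
rewrite qformE; apply: (le_trans (ler_norm_sum _ _ _)); apply: ler_sum => j _.
rewrite normrM -[leRHS]mulr1 ler_pM//; last by rewrite mxE.
apply: (le_trans (ler_norm_sum _ _ _)); apply: ler_sum => i _.
by rewrite normrM mxE -[leRHS]mul1r ler_wpM2r.
Qed.

(** A real [sup] bounds its set only if the set is bounded above; this is checked with the quadratic
    form of the adjoint of [A] times [A]. *)
Lemma opnorm_ge A x : sphere x -> vnorm (A *m x) <= opnorm A.
Proof.
move=> sx; apply: ub_le_sup; last by exists x.
pose S := real_form (map_mx Num.conj A^T *m A).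
exists (Num.sqrt (\sum_j \sum_i `|S i j|)) => _ [y sy <-].
rewrite /vnorm ler_wsqrtr// inner_adjoint -qform_real_form.
by apply: (le_trans (ler_norm _)); apply: qform_le_sum; exact/sphereE.
Qed.

End operator_norm.

(** * Borel-Cantelli *)

Section borel_cantelli.
Context {R : realType} d (T : measurableType d) (P : probability T R).

(** The partial sums telescope and stay below [K]. *)
Lemma telescope_summable (u : nat -> \bar R) (K : R) :
  (forall n, 0 <= u n)%E ->
  (forall n, u n <= (K * (n.+1%:R^-1 - n.+2%:R^-1))%:E)%E ->
  (\sum_(n <oo) u n < +oo)%E.
Proof.
move=> u0 uK; have K0 : 0 <= K.
  have := le_trans (u0 0%N) (uK 0%N); rewrite lee_fin pmulr_lge0//.
  by rewrite subr_gt0 ltf_pV2 ?posrE ?ltr0n// ltr_nat.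
apply: (@le_lt_trans _ _ K%:E); last exact: ltry.
apply: lime_le; first by apply: is_cvg_nneseries => *; exact: u0.
apply: nearW => N.
apply: (@le_trans _ _ (K * (1 - N.+1%:R^-1))%:E); last first.
  by rewrite lee_fin ler_piMr// gerBl invr_ge0 ler0n.
elim: N => [|N IH]; first by rewrite big_geq// invr1 subrr mulr0.
rewrite big_nat_recr//=; apply: (le_trans (leeD IH (uK N))).
by rewrite -EFinD lee_fin -mulrDr addrA subrK.
Qed.

Lemma ae_eventually_notin (F : nat -> set T) (K : R) :
  (forall n, measurable (F n)) ->
  (forall n, (0 < n)%N -> P (F n) <= (K / n%:R ^+ 2)%:E)%E ->
  {ae P, forall w, \forall n \near \oo, ~ F n w}.
Proof.
(* The shift drops the index 0, where no probability bound is assumed. *)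
move=> mF PF; pose G n := F n.+1.
have G0 : P (lim_sup_set G) = 0%E.
  apply: lim_sup_set_cvg0; first by move=> n; exact: mF.
  (* The constant comes from [1 / (n+1)^2 <= 2 / ((n+1)(n+2))], whose right side telescopes. *)
  apply: (@telescope_summable _ (2 * K)); first by move=> n; exact: measure_ge0.
  move=> n; apply: (le_trans (PF _ _)) => //; rewrite lee_fin.
  have K0 : 0 <= K.
    have := le_trans (measure_ge0 P (F 1%N)) (PF 1%N isT).
    by rewrite lee_fin expr1n divr1.
  have n1 : 0 < n.+1%:R :> R by rewrite ltr0n.
  have n2 : 0 < n.+2%:R :> R by rewrite ltr0n.
  rewrite [2 * K]mulrC -mulrA ler_wpM2l//.
  have -> : n.+1%:R^-1 - n.+2%:R^-1 = (n.+1%:R * n.+2%:R)^-1 :> R.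
    by rewrite -[n.+2]addn1 natrD; field; rewrite -natr1 in n2 *; rewrite !gt_eqF.
  rewrite -subr_ge0.
  have -> : 2 * (n.+1%:R * n.+2%:R)^-1 - (n.+1%:R ^+ 2)^-1 =
      (2 * n.+1%:R - n.+2%:R) / (n.+1%:R ^+ 2 * n.+2%:R) :> R.
    by field; rewrite -natr1 in n2 *; rewrite !gt_eqF.
  apply: divr_ge0; last by rewrite mulr_ge0// ?exprn_ge0// ltW.
  by rewrite subr_ge0 -natrM ler_nat mul2n -addnn addSn ltnS addnS ltnS leq_addr.
exists (lim_sup_set G); split => //.
  by apply: bigcap_measurable => // k _; apply: bigcup_measurable => j _; exact: mF.
move=> w /= nF N _; apply: contrapT => nG; apply: nF.
exists N.+1 => // j /= Nj Fj; apply: nG.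
exists j.-1 => /=; first by rewrite -ltnS prednK// (leq_ltn_trans _ Nj).
by rewrite /G prednK// (leq_ltn_trans _ Nj).
Qed.

End borel_cantelli.

(** * Summable tails and almost sure bounds on real parts *)

Section concentration.
Context {R : realType} {d} {T : measurableType d} (P : probability T R).
Context (X : forall n : nat, T -> 'cV[R[i]]_n).
Context (hX : forall n : nat, (0 < n)%N -> uniform_on_sphere P (X n)).

(** With [l = ln n], this is [k l^2 - 2 l + 1/k = (k l - 1)^2 / k >= 0]. *)
Lemma expR_ln_sqr (k : R) n : 0 < k -> (0 < n)%N ->
  expR (- (k * ln n%:R ^+ 2)) <= expR k^-1 / n%:R ^+ 2.
Proof.
move=> k0 n0; set l := ln _.
have nE : n%:R = expR l by rewrite lnK// posrE ltr0n.
rewrite nE -expRM_natl -expRN -expRD ler_expR -subr_ge0.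
have -> : k^-1 - 2%:R * l - - (k * l ^+ 2) = (k * l - 1) ^+ 2 / k.
  by field; exact: lt0r_neq0.
by rewrite divr_ge0 ?sqr_ge0// ltW.
Qed.

(** From [ln n = 2 ln (sqrt n)] and [ln x <= x - 1]. *)
Lemma ln_le_sqrt n : (0 < n)%N -> ln n%:R <= 2 * Num.sqrt n%:R :> R.
Proof.
move=> n0; have s0 : 0 < Num.sqrt n%:R :> R by rewrite sqrtr_gt0 ltr0n.
have h : ln (1 + (Num.sqrt n%:R - 1)) <= Num.sqrt n%:R - 1 :> R.
  by apply: le_ln1Dx; lra.
rewrite addrC subrK in h.
rewrite -[in leLHS](@sqr_sqrtr _ n%:R) ?ler0n// lnXn// mulr2n.
lra.
Qed.

Lemma Re_eventually_le (B : forall n, 'M[R[i]]_n) (C e : R) : 0 < C -> 0 < e ->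
  (forall n, (0 < n)%N -> complex.Re (\tr (B n)) = 0) ->
  (forall n x, (0 < n)%N -> sphere x ->
    ln n%:R * vnorm (B n *m x) <= C * Num.sqrt n%:R) ->
  {ae P, forall w, \forall n \near \oo,
    complex.Re (inner (B n *m X n w) (X n w)) <= e}.
Proof.
move=> C0 e0 trB BC.
(* Indices up to 1 are discarded because the norm bound [L] below divides by [ln n]. *)
pose F n := if (1 < n)%N
  then [set w | e < complex.Re (inner (B n *m X n w) (X n w))] else set0.
(* Since [ln n <= 2 sqrt n], one has [L + e <= D * sqrt n / ln n], so the exponent of [uniform_tail]
   is at least [k * (ln n)^2]. *)
pose D := C + 2 * e; pose k := e ^+ 2 / (8 * D ^+ 2).
have D0 : 0 < D by rewrite /D; lra.
have k0 : 0 < k by rewrite divr_gt0 ?exprn_gt0// mulr_gt0// exprn_gt0.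
have tail n : (1 < n)%N -> measurable (F n) /\
    (P (F n) <= (expR k^-1 / n%:R ^+ 2)%:E)%E.
  move=> n1; have n0 : (0 < n)%N by exact: ltnW.
  have l0 : 0 < ln n%:R :> R by rewrite ln_gt0// ltr1n.
  have s0 : 0 < Num.sqrt n%:R :> R by rewrite sqrtr_gt0 ltr0n.
  pose L := C * Num.sqrt n%:R / ln n%:R.
  have L0 : 0 < L by rewrite divr_gt0// mulr_gt0.
  have BL x : sphere x -> vnorm (B n *m x) <= L.
    by move=> sx; rewrite /L ler_pdivlMr// mulrC; exact: BC.
  have [mF PF] := uniform_tail n d T P (X n) (B n) L e n0 (hX n n0) L0 e0 (trB n n0) BL.
  rewrite /F n1; split=> //; apply: (le_trans PF); rewrite lee_fin.
  apply: le_trans (expR_ln_sqr k n k0 n0); rewrite ler_expR lerN2.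
  have LD : L + e <= D * Num.sqrt n%:R / ln n%:R.
    rewrite (_ : D * _ / _ = L + 2 * e * Num.sqrt n%:R / ln n%:R); last first.
      by rewrite /D /L !mulrDl.
    rewrite lerD2l ler_pdivlMr//.
    by have := ln_le_sqrt n n0; rewrite -(ler_pM2l e0); lra.
  have Le0 : 0 < L + e by lra.
  rewrite ler_pdivlMr; last by rewrite mulr_gt0// exprn_gt0.
  have : (L + e) ^+ 2 <= (D * Num.sqrt n%:R / ln n%:R) ^+ 2.
    by rewrite ler_pXn2r// nnegrE ltW// (lt_le_trans Le0).
  have kl : 0 <= k * ln n%:R ^+ 2 * 8.
    by rewrite mulr_ge0// mulr_ge0 ?sqr_ge0// ltW.
  move=> /(ler_wpM2l kl) h; rewrite [leLHS]mulrA; apply: (le_trans h) => {h}.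
  rewrite le_eqVlt; apply/orP; left; apply/eqP.
  rewrite /k -[X in _ = X * _](@sqr_sqrtr _ n%:R) ?ler0n//.
  by field; rewrite !gt_eqF.
have mF n : measurable (F n).
  by have [/tail[]//|n1] := boolP (1 < n)%N; rewrite /F (negbTE n1).
have PF n : (0 < n)%N -> (P (F n) <= (expR k^-1 / n%:R ^+ 2)%:E)%E.
  move=> _; have [/tail[]//|n1] := boolP (1 < n)%N.
  by rewrite /F (negbTE n1) measure0 lee_fin divr_ge0// ?expR_ge0// exprn_ge0.
apply: filterS (@ae_eventually_notin R d T P F _ mF PF) => w [N _ FN].
exists (maxn 2 N) => // n /=; rewrite geq_max => /andP[n2 Nn].
by have := FN n Nn; rewrite /F n2/= => /negP; rewrite -leNgt.
Qed.

End concentration.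

(** * Almost sure convergence of the complex quadratic forms *)

Lemma complex_norm_le (R : realType) (z : R[i]) (e : R) :
  `|complex.Re z| <= e -> `|complex.Im z| <= e -> `|z| <= (e *+ 2)%:C%C.
Proof.
move=> re im; rewrite normc_def lecR.
have e0 : 0 <= e := le_trans (normr_ge0 _) re.
rewrite -[leRHS]ger0_norm ?mulrn_wge0// -sqrtr_sqr ler_wsqrtr//.
rewrite -(real_normK (num_real (complex.Re z))) -(real_normK (num_real (complex.Im z))).
have sq (a : R) : 0 <= a -> a <= e -> a ^+ 2 <= e ^+ 2.
  by move=> a0 ae; rewrite ler_pXn2r// nnegrE.
have := lerD (sq _ (normr_ge0 _) re) (sq _ (normr_ge0 _) im).
move=> /le_trans; apply; rewrite -mulr2n -mulr_natl -[e *+ 2]mulr_natl exprMn.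
by rewrite ler_wpM2r ?sqr_ge0// -natrX ler_nat.
Qed.

Theorem proposition8p3 (R : realType) (d : measure_display)
    (T : measurableType d) (P : probability T R)
    (A : forall n : nat, 'M[R[i]]_n) (X : forall n : nat, T -> 'cV[R[i]]_n)
    (htr : forall n : nat, (0 < n)%N -> \tr (A n) = 0)
    (hsup : (ereal_sup [set (ln n%:R * opnorm (A n) / Num.sqrt n%:R)%:E
                       | n in [set n : nat | (0 < n)%N]] < +oo)%E)
    (hX : forall n : nat, (0 < n)%N -> uniform_on_sphere P (X n)) :
  {ae P, forall w : T,
    (fun n : nat => inner (A n *m X n w) (X n w)) @ \oo --> (0 : R[i]^o)}.
Proof.
have [C C0 AC] : exists2 C : R, 0 < C & forall n, (0 < n)%N ->
    ln n%:R * opnorm (A n) <= C * Num.sqrt n%:R.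
  have [C C0 supC] : exists2 C : R, 0 < C &
      (ereal_sup [set (ln n%:R * opnorm (A n) / Num.sqrt n%:R)%:E
                 | n in [set n : nat | (0 < n)%N]] <= C%:E)%E.
    (* The maximum with 1 makes the constant positive; the value 1 also serves if the supremum is
       [-oo]. *)
    move: hsup; case: ereal_sup => [r _| //|_]; last by exists 1; rewrite ?ltr01 ?leNye.
    by exists (Num.max r 1); rewrite ?lt_max ?ltr01 ?orbT// lee_fin le_max lexx.
  exists C => // n n0; rewrite -ler_pdivrMr ?sqrtr_gt0 ?ltr0n// -lee_fin.
  by apply: le_trans supC; apply: ereal_sup_ubound; exists n.
pose z n w := inner (A n *m X n w) (X n w).
(* A unimodular factor [c] keeps the trace zero and the norms unchanged, so the one-sided bound on
   real parts holds in every direction. *)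
have ae_le (c : R[i]) (e : R) : conjc c * c = 1 -> 0 < e ->
    {ae P, forall w, \forall n \near \oo, complex.Re (c * z n w) <= e}.
  move=> c1 e0.
  have := @Re_eventually_le R d T P X hX (fun n => c *: A n) C e C0 e0.
  move=> /(_ _ _)H.
  have : {ae P, forall w, \forall n \near \oo,
      complex.Re (inner (c *: A n *m X n w) (X n w)) <= e}.
    apply: H => [n n0|n x n0 sx]; first by rewrite mxtraceZ htr// mulr0.
    rewrite -scalemxAl vnormZ//; apply: le_trans (AC n n0).
    by rewrite ler_wpM2l ?opnorm_ge// ln_ge0// ler1n.
  apply: filterS => w; apply: filterS => n.
  by rewrite -scalemxAl innerZl.
(* Countably many tolerances, so that their exceptional null sets can be united. *)
have ae_all k : {ae P, forall w, \forall n \near \oo, `|z n w| <= (k.+1%:R^-1 *+ 2)%:C%C}.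
  have e0 : 0 < k.+1%:R^-1 :> R by rewrite invr_gt0 ltr0n.
  have c1 : conjc (1 : R[i]) * 1 = 1.
    by apply/eqP; rewrite eq_complex /=; apply/andP; split; apply/eqP; ring.
  have cN1 : conjc (-1 : R[i]) * -1 = 1.
    by apply/eqP; rewrite eq_complex /=; apply/andP; split; apply/eqP; ring.
  have ci : conjc ('i%C : R[i]) * 'i%C = 1.
    by apply/eqP; rewrite eq_complex /=; apply/andP; split; apply/eqP; ring.
  have cNi : conjc (- 'i%C : R[i]) * (- 'i%C) = 1.
    by apply/eqP; rewrite eq_complex /=; apply/andP; split; apply/eqP; ring.
  (* The factors 1 and -1 bound the real part from both sides, ['i] and [- 'i] the imaginary
     part. *)
  apply: filterS2 (filterI (ae_le _ _ c1 e0) (ae_le _ _ cN1 e0))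
    (filterI (ae_le _ _ ci e0) (ae_le _ _ cNi e0)) => w [H1 H2] [H3 H4].
  apply: filterS2 (filterI H1 H2) (filterI H3 H4) => n.
  rewrite /setI/= mul1r mulN1r mulNr.
  case: (z n w) => a b /=.
  move: (_^-1) => e; rewrite !mul0r !mul1r !sub0r !opprK => -[h1 h2] [h3 h4].
  by apply: complex_norm_le; rewrite /= ler_norml; apply/andP; split;
    rewrite // lerNl.
apply: filterS (ae_foralln ae_all) => w H.
apply/(@cvgrPdist_lt R[i] R[i]^o) => /= eps eps0.
have [e e0 epsE] : exists2 e : R, 0 < e & eps = e%:C%C.
  exists (complex.Re eps); last by rewrite RRe_real// gtr0_real.
  by move: eps0; rewrite ltcE/= => /andP[].
(* The Archimedean property, applied to [2 / e], provides a tolerance below [e]. *)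
have [k ke] : exists k : nat, k.+1%:R^-1 *+ 2 < e.
  exists (Num.bound (2 / e)); rewrite -[X in X < _]mulr_natl ltr_pdivrMr ?ltr0n//.
  rewrite mulrC -ltr_pdivrMr//; apply: (lt_le_trans (archi_boundP _)).
    by rewrite divr_ge0// ltW.
  by rewrite ler_nat.
apply: filterS (H k) => n hn.
by rewrite sub0r normrN (le_lt_trans hn)// epsE ltcR.
Qed.
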